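(* Let $k\geq 1$ and let $D$ be a $k$-minimal digraph. Let $\varphi$ be an acyclic and complete coloring of $D$ with exactly $k$ colors, with chromatic classes $V_1,\dots,V_k$, where $|V_i|=q_i$ and $V_i=\{u_{i,1},\dots,u_{i,q_i}\}$. For each $i\in[k]$ let $m_i\geq 2$ and let $X_i=\{H_{u_{i,1}},\dots,H_{u_{i,q_i}}\}$ be a relabel factorization of $K_{m_i}$ into $q_i$ factors, where all the digraphs $H_{u_{i,j}}$ ($i\in[k]$, $j\in[q_i]$) are pairwise vertex-disjoint. Let $X=\bigcup_{i=1}^k X_i=\{H_u : u\in V(D)\}$ and $t=\sum_{i=1}^k m_i$. Then the Zykov sum $D[X]$ is $t$-minimal.
   Context: All digraphs are finite and simple (no loops, no parallel arcs; two opposite arcs forming a 2-cycle are allowed). $[n]=\{1,\dots,n\}$. $K_m$ denotes the complete symmetric digraph on $m$ vertices (every ordered pair of distinct vertices is an arc). A vertex coloring with $k$ colors is a surjection $V(D)\to[k]$; its chromatic classes are the preimages of the colors. A coloring is acyclic if each chromatic class induces a subdigraph with no directed cycle. A coloring is complete if for every ordered pair $(i,j)$ of distinct colors there is at least one arc $uv$ with $u$ colored $i$ and $v$ colored $j$. The diachromatic number $\mathrm{dac}(D)$ is the largest $k$ for which $D$ has an acyclic and complete coloring with $k$ colors. $D$ is $k$-minimal if $\mathrm{dac}(D)=k$ and $\mathrm{dac}(D-f)<k$ for every arc $f$ of $D$ (it is known that a digraph with $\mathrm{dac}(D)=k$ is $k$-minimal iff it has exactly $k(k-1)$ arcs). A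 relabel factorization of $K_m$ into $q$ factors is a family of $q$ pairwise vertex-disjoint digraphs $H_1,\dots,H_q$, where $H_j$ has vertex set $\{v^1_j,\dots,v^m_j\}$, such that for every ordered pair $(a,b)$ of distinct elements of $[m]$ there is exactly one $j\in[q]$ with $v^a_jv^b_j\in A(H_j)$, and every arc of every $H_j$ is of this form (equivalently, identifying each $v^l_j$ with vertex $l$ of $K_m$, the $H_j$ are spanning subdigraphs of $K_m$ whose arc sets partition $A(K_m)$). Zykov sum: given a digraph $D$ and a family $X=\{H_u: u\in V(D)\}$ of nonempty pairwise vertex-disjoint digraphs, $D[X]$ has vertex set $\bigcup_u V(H_u)$ and arc set $\bigcup_u A(H_u)\cup\{ab: a\in V(H_u), b\in V(H_v), uv\in A(D)\}$. *)

(* Defs.v *)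
From HB Require Import structures.
From mathcomp Require Import all_boot.
From mathcomp Require Import boolp.

Set Implicit Arguments.
Unset Strict Implicit.
Unset Printing Implicit Defensive.

Record digraph := Digraph {
  vertex :> finType;
  arc : rel vertex;
  arc_irr : irreflexive arc }.

Arguments arc {d} _ _.

Section Constructions.
Variable D : digraph.

Definition del_arc_rel (x y : D) : rel D :=
  [rel a b | arc a b && ((a, b) != (x, y))].

Fact del_arc_irr (x y : D) : irreflexive (del_arc_rel x y).
Proof. by move=> a; rewrite /del_arc_rel /= arc_irr. Qed.

Definition del_arc (x y : D) : digraph := Digraph (del_arc_irr x y).

Definition induced_rel (S : {set D}) : rel {x : D | x \in S} :=
  [rel a b | arc (val a) (val b)].

Fact induced_irr (S : {set D}) : irreflexive (@induced_rel S).
Proof. by move=> a; rewrite /induced_rel /= arc_irr. Qed.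

Definition induced (S : {set D}) : digraph := Digraph (@induced_irr S).

(* The disjoint union of the vertex sets is the sigma type {u : D & H u}, so
   the summands are vertex-disjoint by construction. *)
Definition zykov_rel (H : D -> digraph) : rel {u : D & H u} :=
  [rel a b | arc (tag a) (tag b)
          || (tag a == tag b) && arc (tagged a) (tagged_as a b)].

Fact zykov_irr (H : D -> digraph) : irreflexive (@zykov_rel H).
Proof. by case=> u x; rewrite /zykov_rel /= tagged_asE !arc_irr andbF. Qed.

Definition zykov (H : D -> digraph) : digraph := Digraph (@zykov_irr H).

End Constructions.

Definition acyclic (D : digraph) : Prop :=
  forall c : seq D, c != [::] -> ~ ucycle arc c.

Section Colorings.
Variables (D : digraph) (k : nat) (phi : D -> 'I_k).

Definition is_coloring : Prop := forall i, exists u, phi u = i.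

Definition chromatic_class (i : 'I_k) : {set D} := [set u | phi u == i].

Definition acyclic_coloring : Prop :=
  forall i, acyclic (induced (chromatic_class i)).

Definition complete_coloring : Prop :=
  forall i j : 'I_k, i != j ->
  exists u v : D, [/\ arc u v, phi u = i & phi v = j].

Definition acyclic_complete_coloring : Prop :=
  [/\ is_coloring, acyclic_coloring & complete_coloring].

End Colorings.

(* A surjection onto k colors forces k <= #|D|, so the bound on k is harmless:
   see leq_dac and dac_attained. *)
Definition dac (D : digraph) : nat :=
  \max_(k < #|D|.+1
        | `[< exists phi : D -> 'I_k, acyclic_complete_coloring phi >]) k.

Lemma leq_dac (D : digraph) (k : nat) (phi : D -> 'I_k) :
  acyclic_complete_coloring phi -> k <= dac D.
Proof.
move=> Hphi; have [surj _ _] := Hphi.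
have lekD : k < #|D|.+1.
  rewrite ltnS -[k in k <= _]card_ord.
  have -> : #|'I_k| = #|codom phi|.
    apply: eq_card => i; rewrite inE; apply/esym.
    by have [u <-] := surj i; rewrite codom_f.
  exact: leq_image_card.
rewrite /dac (bigD1 (Ordinal lekD)) /=; first exact: leq_maxl.
by apply/asboolP; exists phi.
Qed.

Lemma dac_attained (D : digraph) : 0 < dac D ->
  exists phi : D -> 'I_(dac D), acyclic_complete_coloring phi.
Proof.
rewrite /dac; elim/big_rec: _ => //= i n Pi IHn.
by case: (leqP i n) => // _ _; apply/asboolP.
Qed.

Definition minimal_digraph (k : nat) (D : digraph) : Prop :=
  dac D = k /\ forall x y : D, arc x y -> dac (del_arc x y) < k.

(* v j a is the vertex v^a_j; the factors are indexed by a finite type J, so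
   their number is #|J|. *)
Definition relabel_factorization (m : nat) (J : finType) (H : J -> digraph)
    : Prop :=
  exists v : forall j : J, 'I_m -> H j,
  [/\ forall j, bijective (v j),
      forall a b : 'I_m, a != b -> exists! j : J, arc (v j a) (v j b)
    & forall j (x y : H j), arc x y ->
      exists a b : 'I_m, [/\ a != b, x = v j a & y = v j b]].

(* Main.v *)
(** Deleting an arc that is monochromatic, or that shares its ordered pair of
    colors with another arc, leaves an acyclic complete coloring acyclic and
    complete.  Hence in a [k]-minimal digraph sending an arc to the ordered pair
    of colors of its ends is injective, with off-diagonal values.  Conversely a
    digraph with a complete [k]-coloring of this kind has at most [k (k - 1)]
    arcs, while a complete coloring with [s] colors requires at least
    [s (s - 1)] arcs; so the digraph is [k]-minimal.  This criterion applies to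
    the Zykov sum when the vertex [v^a_u] of [H_u] gets the color
    [(phi u, a)]. *)

Require Import Defs.
From HB Require Import structures.
From mathcomp Require Import all_boot.
From mathcomp Require Import boolp.
(* Rebinds [arc], which all_boot shadows with [path.arc]. *)
Import Defs.

Set Implicit Arguments.
Unset Strict Implicit.
Unset Printing Implicit Defensive.

Definition arc_set (D : digraph) : {set D * D} := [set p | arc p.1 p.2].

(** The type of colors is arbitrary, so that one notion covers ['I_k] for [D] and the type of pairs
    (class, label) for the Zykov sum. *)
Definition tight_coloring (D : digraph) (T : Type) (c : D -> T) : Prop :=
  (forall x y : D, arc x y -> c x <> c y) /\
  (forall x y x' y' : D, arc x y -> arc x' y' ->
     c x = c x' -> c y = c y' -> x = x' /\ y = y').

Lemma card_offdiag (T : finType) :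
  #|[set p : T * T | p.1 != p.2]| = #|T| * (#|T|).-1.
Proof.
have -> : [set p : T * T | p.1 != p.2] = ~: [set (x, x) | x : T].
  apply/setP=> -[x y]; rewrite !inE /=; congr negb.
  by apply/eqP/imsetP => [->|[z _ [-> ->]]]; first exists y.
rewrite cardsCs setCK card_imset; last by move=> x y [].
by rewrite card_prod -[X in _ - X]muln1 -mulnBr subn1.
Qed.

Lemma complete_coloring_arcs (D : digraph) (s : nat) (psi : D -> 'I_s) :
  complete_coloring psi -> s * s.-1 <= #|arc_set D|.
Proof.
move=> compl; rewrite -[s]card_ord -card_offdiag.
apply: leq_trans (leq_imset_card (fun p : D * D => (psi p.1, psi p.2)) _).
apply/subset_leq_card/subsetP => -[i j]; rewrite inE /= => /compl.
by case=> u [v [uv <- <-]]; apply/imsetP; exists (u, v); rewrite ?inE.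
Qed.

Lemma tight_coloring_arcs (D : digraph) (T : finType) (c : D -> T) :
  tight_coloring c -> #|arc_set D| <= #|T| * (#|T|).-1.
Proof.
move=> [het inj]; rewrite -card_offdiag.
rewrite -(card_in_imset (f := fun p : D * D => (c p.1, c p.2))); last first.
  move=> [x y] [x' y']; rewrite !inE /= => xy xy' [cx cy].
  by have [-> ->] := inj _ _ _ _ xy xy' cx cy.
apply/subset_leq_card/subsetP => _ /imsetP[[x y] + ->].
by rewrite !inE /= => /het/eqP.
Qed.

(** Positivity of [t] excludes [s = 1], [t = 0], where both products vanish. *)
Lemma leq_mul_pred (s t : nat) : 0 < t -> s * s.-1 <= t * t.-1 -> s <= t.
Proof.
move=> t0; apply: contraTT; rewrite -!ltnNge => ts.
case: s ts => //= s ts; apply: (leq_trans (n := t.+1 * t)).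
  by rewrite mulnC ltn_mul2r t0 ltnS leq_pred.
by rewrite leq_mul.
Qed.

Lemma acyclic_arcless (D : digraph) :
  (forall x y : D, ~~ arc x y) -> acyclic D.
Proof.
move=> no_arc [|x c] //= _ /andP[].
by case: c => [|y c] /=; rewrite (negPf (no_arc _ _)).
Qed.

Lemma acyclic_subrel (V : finType) (e e' : rel V)
    (irr : irreflexive e) (irr' : irreflexive e') :
  subrel e' e -> acyclic (Digraph irr) -> acyclic (Digraph irr').
Proof.
move=> sub acy c c0 /andP[cyc un]; apply: (acy c c0).
by rewrite /ucycle un (sub_cycle sub cyc).
Qed.

Lemma minimal_coloring_tight (D : digraph) (k : nat) (phi : D -> 'I_k) :
  minimal_digraph k D -> acyclic_complete_coloring phi -> tight_coloring phi.
Proof.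
move=> [_ dmin] [surj acy compl].
(* After deleting an arc, [phi] is still surjective with acyclic classes; were it also complete,
   [dac] would not drop below [k]. *)
have needed (x y : D) : arc x y ->
    ~ complete_coloring (phi : del_arc x y -> 'I_k).
  move=> xy compl'; have := dmin x y xy; rewrite ltnNge => /negP; apply.
  apply: (leq_dac (D := del_arc x y) (phi := phi)); split => // i.
  by apply: acyclic_subrel (acy i) => a b /= /andP[].
split=> [x y xy exy|x y x' y' xy xy' ex ey].
  apply: (needed x y xy) => i j ij.
  have [u [v [uv ui vj]]] := compl i j ij; exists u, v; split => //.
  apply/andP; split=> //; apply: contra ij => /eqP[eu ev].
  by rewrite -ui -vj eu ev exy.
(* If the arcs differ, [(x', y')] takes over the color pair of the deleted [(x, y)]. *)
apply/pair_equal_spec/eqP; apply: contraT => neq.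
case: (needed x y xy) => i j ij.
have [u [v [uv ui vj]]] := compl i j ij.
have [[eu ev]|nuv] := eqVneq (u, v) (x, y); last first.
  by exists u, v; split=> //; apply/andP.
exists x', y'; split; [|by rewrite -ex -eu|by rewrite -ey -ev].
by apply/andP; split; rewrite // eq_sym.
Qed.

Lemma tight_coloring_minimal (D : digraph) (T : finType) (c : D -> T) :
  0 < #|T| -> (forall i, exists u, c u = i) ->
  (forall i j : T, i != j -> exists u v : D, [/\ arc u v, c u = i & c v = j]) ->
  tight_coloring c -> minimal_digraph #|T| D.
Proof.
move=> T0 surj compl tight; have arcs_le := tight_coloring_arcs tight.
(* Stated for any [E], as it serves both [D] and [D] with an arc deleted. *)
have dac_le (E : digraph) : #|arc_set E| <= #|T| * (#|T|).-1 -> dac E <= #|T|.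
  move=> leE; case: (posnP (dac E)) => [-> //|/dac_attained[psi [_ _ psiC]]].
  apply: leq_mul_pred => //; apply: leq_trans leE.
  exact: complete_coloring_arcs psiC.
split=> [|x y xy].
  apply/eqP; rewrite eqn_leq dac_le //=.
  apply: (leq_dac (phi := fun x => enum_rank (c x))); split.
  - by move=> i; have [u cu] := surj (enum_val i); exists u; rewrite cu enum_valK.
  (* Tightness leaves no arc inside a color class. *)
  - move=> i; apply: acyclic_arcless => u v; apply/negP => /tight.1; apply; apply: enum_rank_inj.
    by move: (valP u) (valP v); rewrite !inE => /eqP-> /eqP->.
  - move=> i j; rewrite -(inj_eq enum_val_inj) => /compl[u [v [uv cu cv]]].
    by exists u, v; rewrite cu cv !enum_valK.
have arcs_lt : #|arc_set (del_arc x y)| < #|T| * (#|T|).-1.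
  apply: leq_trans arcs_le; apply: proper_card; apply/properP; split.
    by apply/subsetP => p; rewrite !inE => /andP[].
  by exists (x, y); rewrite !inE //; apply/negP => /andP[_ /eqP].
rewrite ltn_neqAle dac_le ?(ltnW arcs_lt) // andbT.
(* Equality would give a complete coloring with [#|T|] colors, for which too few arcs remain. *)
apply/eqP => dacE.
have [|psi [_ _ /complete_coloring_arcs]] := @dac_attained (del_arc x y).
  by rewrite dacE.
by rewrite dacE leqNgt arcs_lt.
Qed.

Section ZykovColoring.
Variables (k : nat) (D : digraph) (phi : D -> 'I_k) (m : 'I_k -> nat).
Variable H : D -> digraph.
Local Notation V i := {u : D | u \in chromatic_class phi i}.
Variable v : forall (i : 'I_k) (j : V i), 'I_(m i) -> H (sval j).
Hypothesis v_bij : forall i (j : V i), bijective (v j).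

Definition zykov_vertex (i : 'I_k) (j : V i) (a : 'I_(m i)) : zykov H :=
  Tagged (fun u => H u : Type) (v j a).

Lemma color_class i (j : V i) : phi (sval j) = i.
Proof. by have := valP j; rewrite inE => /eqP. Qed.

Lemma zykov_vertexP (x : zykov H) :
  exists i (j : V i) a, x = zykov_vertex j a.
Proof.
case: x => u h.
have Vu : u \in chromatic_class phi (phi u) by rewrite inE.
pose j : V (phi u) := exist _ u Vu.
have [g _ gK] := v_bij j.
by exists (phi u), j, (g h); rewrite /zykov_vertex gK.
Qed.

(** This makes the color (class, label) of a vertex well defined. The labels are compared as tagged
    elements because their types depend on the class. *)
Lemma zykov_vertex_inj i (j : V i) a i' (j' : V i') a' :
  zykov_vertex j a = zykov_vertex j' a' ->
  Tagged (fun i => 'I_(m i)) a = Tagged (fun i => 'I_(m i)) a'.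
Proof.
move=> e; have ej : sval j = sval j' := congr1 tag e.
have := congr1 phi ej; rewrite !color_class => ei.
case: i' / ei j' a' e ej => j' a' e /val_inj ej.
case: j' / ej e => /eqP.
by rewrite eq_Tagged /= => /eqP/(bij_inj (v_bij j))->.
Qed.

Lemma zykov_coloring_exists :
  exists c : zykov H -> {i : 'I_k & 'I_(m i)},
  forall i (j : V i) a, c (zykov_vertex j a) = Tagged (fun i => 'I_(m i)) a.
Proof.
have /choice[c cP] : forall x : zykov H, exists t : {i : 'I_k & 'I_(m i)},
    exists j : V (tag t), x = zykov_vertex j (tagged t).
  move=> x; have [i [j [a ->]]] := zykov_vertexP x.
  by exists (Tagged (fun i => 'I_(m i)) a), j.
exists c => i j a; have [j' /zykov_vertex_inj->] := cP (zykov_vertex j a).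
by case: (c _).
Qed.

Lemma arc_zykov_vertex i (j : V i) a b :
  arc (zykov_vertex j a) (zykov_vertex j b) = arc (v j a) (v j b).
Proof.
rewrite -[LHS]/(zykov_rel (zykov_vertex j a) (zykov_vertex j b)) /zykov_rel.
by rewrite /zykov_vertex /= tagged_asE arc_irr eqxx.
Qed.

Hypothesis phi_tight : tight_coloring phi.

(** An arc of the sum comes from an arc of [D], whose ends have distinct colors by tightness of
    [phi], or lies inside one summand. *)
Lemma zykov_arcP i (j : V i) a i' (j' : V i') a' :
  arc (zykov_vertex j a) (zykov_vertex j' a') ->
  i != i' /\ arc (sval j) (sval j') \/ i = i' /\ sval j = sval j'.
Proof.
case/orP=> [/= uv|/andP[/eqP /= e _]]; [left|right].
  by split=> //; have := phi_tight.1 _ _ uv; rewrite !color_class => /eqP.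
by split=> //; have := congr1 phi e; rewrite !color_class.
Qed.

Lemma zykov_coloring_tight (c : zykov H -> {i : 'I_k & 'I_(m i)}) :
  (forall i (j : V i) a, c (zykov_vertex j a) = Tagged (fun i => 'I_(m i)) a) ->
  (forall i (a b : 'I_(m i)), a != b -> exists! j : V i, arc (v j a) (v j b)) ->
  tight_coloring c.
Proof.
move=> cE v_uniq; split=> [x y|x y x' y'].
  have [i [j [a ->]]] := zykov_vertexP x.
  have [i' [j' [a' ->]]] := zykov_vertexP y.
  (* Inside one summand, equal labels would make the arc a loop. *)
  move=> /[dup] xy /zykov_arcP[[ii' _]|[ei ej]]; rewrite !cE.
    by move=> /(congr1 tag) /= e; rewrite e eqxx in ii'.
  case: i' / ei j' a' ej xy => j' a' /val_inj ej.
  case: j' / ej => xy /eqP; rewrite eq_Tagged => /eqP /= e.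
  by move: xy; rewrite e arc_irr.
have [i [j [a ->]]] := zykov_vertexP x.
have [p [q [b ->]]] := zykov_vertexP y.
have [i' [j' [a' ->]]] := zykov_vertexP x'.
have [p' [q' [b' ->]]] := zykov_vertexP y'.
rewrite !cE => xy xy' ex ey.
have ei : i = i' := congr1 tag ex.
have ep : p = p' := congr1 tag ey.
case: i' / ei j' a' ex xy' => j' a' /eqP; rewrite eq_Tagged => /eqP /= <- {a'}.
case: p' / ep q' b' ey => q' b' /eqP; rewrite eq_Tagged => /eqP /= <- {b'} xy'.
(* The classes of the ends agree for both arcs, so both come from [D], where [phi_tight] applies, or
   both lie inside summands, where uniqueness of the factor applies. *)
case: (zykov_arcP xy) => [[ip jq]|[ei ej]].
  case: (zykov_arcP xy') => [[_ jq']|[e _]]; last by rewrite e eqxx in ip.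
  have [] := phi_tight.2 _ _ _ _ jq jq'; rewrite ?color_class //.
  by move=> /val_inj-> /val_inj->.
case: p / ei q b q' ej xy xy' => q b q' ej xy xy'.
have {}ej : j = q := val_inj ej.
have ej' : j' = q'.
  by case: (zykov_arcP xy') => [[]|[_ /val_inj //]]; rewrite eqxx.
case: q / ej xy => /[!arc_zykov_vertex] xy.
case: q' / ej' xy' => xy'.
have ab : a != b by apply: contraTneq xy => ->; rewrite arc_irr.
have [j0 [_ uj]] := v_uniq i a b ab; rewrite -(uj j xy) -(uj j') //.
by rewrite -arc_zykov_vertex.
Qed.

End ZykovColoring.

Theorem theorem2 (k : nat) (k_ge1 : 1 <= k) (D : digraph)
    (D_min : minimal_digraph k D)
    (phi : D -> 'I_k) (phi_ac : acyclic_complete_coloring phi)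
    (m : 'I_k -> nat) (m_ge2 : forall i : 'I_k, 2 <= m i)
    (H : D -> digraph)
    (H_fact : forall i : 'I_k,
       @relabel_factorization (m i) {u : D | u \in chromatic_class phi i}
         (fun u => H (sval u))) :
  minimal_digraph (\sum_(i < k) m i) (zykov H).
Proof.
have phi_tight := minimal_coloring_tight D_min phi_ac.
have [surj _ compl] := phi_ac.
pose v i := sval (cid (H_fact i)).
have v_bij i j : bijective (v i j) by case: (svalP (cid (H_fact i))).
have v_uniq i (a b : 'I_(m i)) : a != b -> exists! j, arc (v i j a) (v i j b).
  by case: (svalP (cid (H_fact i))) => _ + _; apply.
have inV u i : phi u = i -> u \in chromatic_class phi i by rewrite inE => ->.
have [c cE] := zykov_coloring_exists v_bij.
have cardT : #|{: {i : 'I_k & 'I_(m i)}}| = \sum_(i < k) m i.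
  rewrite card_tagged sumnE big_map big_enum.
  by apply: eq_bigr => i _; rewrite card_ord.
rewrite -cardT; apply: (tight_coloring_minimal (c := c)).
- have i0 := Ordinal k_ge1.
  apply/card_gt0P.
  by exists (Tagged (fun i => 'I_(m i)) (Ordinal (ltnW (m_ge2 i0)))).
- move=> [i a]; have [u /inV Vu] := surj i.
  by exists (zykov_vertex v (exist _ u Vu) a); rewrite cE.
(* Within one class, the factor that contains the arc from [a] to [b] provides the witness. For
   distinct classes, completeness of [phi] gives an arc of [D], and the sum joins all vertices of
   the two summands, whatever their labels. *)
- move=> [i a] [i' a']; have [ei|ii' _] := eqVneq i i'.
    case: i' / ei a' => b neq.
    have /v_uniq[j [ab _]] : a != b by apply: contraNneq neq => ->.
    by exists (zykov_vertex v j a), (zykov_vertex v j b); rewrite !cE arc_zykov_vertex.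
  have [x [y [xy /inV Vx /inV Vy]]] := compl i i' ii'.
  exists (zykov_vertex v (exist _ x Vx) a), (zykov_vertex v (exist _ y Vy) a').
  by rewrite !cE; split => //; apply/orP; left.
- exact: (zykov_coloring_tight v_bij phi_tight cE v_uniq).
Qed.
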